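(* Let $k$ be any field. Then there exists some integer $d \geq 3$ such that the path algebra $k\Theta(d)$ of the generalised Kronecker quiver $\Theta(d)$ is not of amenable representation type.
   Context: The generalised Kronecker quiver $\Theta(d)$ has two vertices $1,2$ and exactly $d$ arrows, all going from $1$ to $2$. Modules over $k\Theta(d)$ are identified with representations of $\Theta(d)$ over $k$. Let $A$ be a finite dimensional $k$-algebra and let $\mathcal{M}$ be a set of finite dimensional $A$-modules. $\mathcal{M}$ is hyperfinite if for every $\varepsilon > 0$ there exists a number $L_\varepsilon > 0$ such that for every $M \in \mathcal{M}$ there exist a submodule $N \subseteq M$ with $\dim_k N \geq (1-\varepsilon)\dim_k M$ and finite dimensional $A$-modules $N_1,\dots,N_t$ with $\dim_k N_i \leq L_\varepsilon$ for all $i$, such that $N \cong \bigoplus_{i=1}^t N_i$. The algebra $A$ is of amenable representation type if the set of all finite dimensional $A$-modules (more precisely, a set meeting every isomorphism class of finite dimensional $A$-modules) is hyperfinite. *)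

(* Defs.v *)
From HB Require Import structures.
From mathcomp Require Import all_boot all_order all_algebra all_field.
From mathcomp Require Import reals.

Set Implicit Arguments.
Unset Strict Implicit.
Unset Printing Implicit Defensive.

Import Order.TTheory GRing.Theory Num.Theory.
Local Open Scope ring_scope.

(* The vertices 1 and 2 are encoded as false and true.  The paths are the two
   trivial paths inl v and the arrows inr i. *)
Definition kpath (d : nat) : Type := (bool + 'I_d)%type.

HB.instance Definition _ d := Finite.on (kpath d).

Definition psource d (p : kpath d) : bool := if p is inl v then v else false.
Definition ptarget d (p : kpath d) : bool := if p is inl v then v else true.

(* "q after p"; with this convention left modules over the path algebra are
   the covariant representations of the quiver. *)
Definition pcomp d (q p : kpath d) : option (kpath d) :=
  if ptarget p == psource q then
    match q, p with
    | inl _, _ => Some p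
    | inr _, inl _ => Some q
    | inr _, inr _ => None (* does not occur: arrows are not composable *)
    end
  else None.

(* The path algebra: functions on the basis of paths, with the product
   extending composition of paths bilinearly (non-composable paths have
   product zero).  The alias hides the pointwise product of {ffun _ -> _}. *)
Definition kronecker_algebra (k : fieldType) (d : nat) : Type :=
  {ffun kpath d -> k^o}.

Section KroneckerAlgebra.
Variables (k : fieldType) (d : nat).
Local Notation A := (kronecker_algebra k d).

HB.instance Definition _ := Vector.copy A {ffun kpath d -> k^o}.

Definition kone : A := [ffun p => if p is inl _ then 1 else 0 : k].

Definition kmul (f g : A) : A :=
  [ffun r => \sum_(qp : kpath d * kpath d | pcomp qp.1 qp.2 == Some r)
               (f qp.1 * g qp.2 : k)].

Lemma kmul_vertex f g v : kmul f g (inl v) = f (inl v) * g (inl v).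
Proof.
rewrite ffunE (big_pred1 (inl v, inl v)) // => -[[u|i] [w|j]] //=.
- by rewrite /pcomp /=; case: u w v => [] [] [].
- by rewrite /pcomp /=; case: u v => [] [].
- by rewrite /pcomp /=; case: w v => [] [].
Qed.

Lemma kmul_arrow f g i :
  kmul f g (inr i) = f (inr i) * g (inl false) + f (inl true) * g (inr i).
Proof.
rewrite ffunE (bigD1 (inr i, inl false)) //=; congr (_ + _).
rewrite (bigD1 (inl true, inr i)) /= ?andbT //.
rewrite big1 ?addr0 // => -[[u|a] [w|b]] /=.
- by rewrite /pcomp /=; case: u w => [] [].
- rewrite /pcomp /=; case: u => //= /andP[/andP[/eqP[->] _]].
  by rewrite eqxx.
- rewrite /pcomp /=; case: w => //= /andP[/andP[/eqP[->]]].
  by rewrite eqxx.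
- by [].
Qed.

Definition kmulE := (kmul_vertex, kmul_arrow).

Fact kmulA : associative kmul.
Proof.
move=> f g h; apply/ffunP => -[v|i]; rewrite !kmulE ?mulrA //.
by rewrite mulrDl mulrDr !mulrA addrA.
Qed.

Fact kmul1 : left_id kone kmul.
Proof.
by move=> f; apply/ffunP => -[v|i]; rewrite !kmulE !ffunE ?mul1r ?mul0r ?add0r.
Qed.

Fact kmulr1 : right_id kone kmul.
Proof.
by move=> f; apply/ffunP => -[v|i]; rewrite !kmulE !ffunE ?mulr1 ?mulr0 ?addr0.
Qed.

Fact kmulDl : left_distributive kmul +%R.
Proof.
move=> f g h; apply/ffunP => -[v|i]; rewrite [RHS]ffunE !kmulE !ffunE ?mulrDl //.
by rewrite addrACA.
Qed.

Fact kmulDr : right_distributive kmul +%R.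
Proof.
move=> f g h; apply/ffunP => -[v|i]; rewrite [RHS]ffunE !kmulE !ffunE ?mulrDr //.
by rewrite addrACA.
Qed.

Fact kone_neq0 : kone != 0.
Proof.
apply/eqP => /ffunP/(_ (inl false)); rewrite !ffunE => /eqP.
by rewrite (oner_eq0 k).
Qed.

HB.instance Definition _ := GRing.Zmodule_isNzRing.Build A
  kmulA kmul1 kmulr1 kmulDl kmulDr kone_neq0.

Fact kscaleAl (a : k) (f g : A) : a *: (f * g) = (a *: f) * g.
Proof.
apply/ffunP => -[v|i]; rewrite [LHS]ffunE !kmulE !ffunE /GRing.scale/= ?mulrA //.
by rewrite mulrDr !mulrA.
Qed.

Fact kscaleAr (a : k) (f g : A) : a *: (f * g) = f * (a *: g).
Proof.
apply/ffunP => -[v|i]; rewrite [LHS]ffunE !kmulE !ffunE /GRing.scale/=.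
  by rewrite mulrCA.
by rewrite mulrDr !(mulrCA a).
Qed.

HB.instance Definition _ := GRing.Lmodule_isLalgebra.Build k A kscaleAl.
HB.instance Definition _ := GRing.Lalgebra_isAlgebra.Build k A kscaleAr.
HB.instance Definition _ := Algebra_isFalgebra.Build k A.

End KroneckerAlgebra.

Section Modules.
Variables (k : fieldType) (A : falgType k).

(* Finite-dimensional left A-modules. *)
Record fdmod := FdMod {
  fdmod_car :> vectType k;
  act : A -> fdmod_car -> fdmod_car;
  act_linearl : forall m, linear (act^~ m);
  act_linearr : forall a, linear (act a);
  act1 : forall m, act 1 m = m;
  actM : forall a b m, act (a * b) m = act a (act b m) }.

Definition mod_iso (M N : fdmod) : Prop :=
  exists f : 'Hom(M, N), bijective f /\ forall a m, f (act a m) = act a (f m).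

Definition submodule (M : fdmod) (U : {vspace M}) : Prop :=
  forall a m, m \in U -> act a m \in U.

Section SubModule.
Variables (M : fdmod) (U : {vspace M}) (sU : submodule U).

Definition sub_act (a : A) (u : subvs_of U) : subvs_of U :=
  Subvs (sU a (subvsP u)).

Fact sub_act_linearl u : linear (sub_act^~ u).
Proof. by move=> c a b; apply/val_inj; rewrite /= act_linearl. Qed.
Fact sub_act_linearr a : linear (sub_act a).
Proof. by move=> c u v; apply/val_inj; rewrite /= act_linearr. Qed.
Fact sub_act1 u : sub_act 1 u = u.
Proof. by apply/val_inj; rewrite /= act1. Qed.
Fact sub_actM a b u : sub_act (a * b) u = sub_act a (sub_act b u).
Proof. by apply/val_inj; rewrite /= actM. Qed.

Definition mod_of_sub : fdmod :=
  @FdMod (subvs_of U) sub_act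
    sub_act_linearl sub_act_linearr sub_act1 sub_actM.

End SubModule.

Section DirectSum.

Definition zero_act (a : A) (m : 'rV[k]_0) : 'rV[k]_0 := m.

Fact zero_act_linearl m : linear (zero_act^~ m).
Proof. by move=> c a b; rewrite [LHS]thinmx0 [RHS]thinmx0. Qed.
Fact zero_act_linearr a : linear (zero_act a). Proof. by []. Qed.
Fact zero_act1 m : zero_act 1 m = m. Proof. by []. Qed.
Fact zero_actM a b m : zero_act (a * b) m = zero_act a (zero_act b m).
Proof. by []. Qed.

Definition mod_zero : fdmod :=
  @FdMod 'rV[k]_0 zero_act
    zero_act_linearl zero_act_linearr zero_act1 zero_actM.

Variables (M N : fdmod).

Definition sum_act (a : A) (x : M * N) : M * N := (act a x.1, act a x.2).

Fact sum_act_linearl x : linear (sum_act^~ x).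
Proof. by move=> c a b; rewrite /sum_act !act_linearl. Qed.
Fact sum_act_linearr a : linear (sum_act a).
Proof. by move=> c x y; rewrite /sum_act /= !act_linearr. Qed.
Fact sum_act1 x : sum_act 1 x = x.
Proof. by case: x => x y; rewrite /sum_act /= !act1. Qed.
Fact sum_actM a b x : sum_act (a * b) x = sum_act a (sum_act b x).
Proof. by rewrite /sum_act /= !actM. Qed.

Definition mod_sum : fdmod :=
  @FdMod (M * N)%type sum_act
    sum_act_linearl sum_act_linearr sum_act1 sum_actM.

End DirectSum.

Variable R : realType.

Definition hyperfinite (S : fdmod -> Prop) : Prop :=
  forall eps : R, 0 < eps ->
  exists L : R, 0 < L /\
  forall M : fdmod, S M ->
  exists (U : {vspace M}) (sU : submodule U) (t : nat) (N : 'I_t -> fdmod),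
    [/\ (1 - eps) * (\dim {:M})%:R <= (\dim U)%:R,
        forall i, (\dim {:N i})%:R <= L
      & mod_iso (mod_of_sub sU) (\big[mod_sum/mod_zero]_(i < t) N i)].

Definition amenable_type : Prop := hyperfinite (fun _ => True).

End Modules.

Arguments amenable_type {k} A R.
Arguments hyperfinite {k A} R S.

(* Main.v *)
(* Let X and Y be finite ranked sets and f_i : X -> Y (i < d) strictly
   monotone maps.  They induce linear maps T_i : kX -> kY, i.e. a Kronecker
   module.  Since T_i maps leading positions to leading positions, for every
   subspace V of kX the dimension of sum_i T_i V is at least the number of
   neighbours, in the bipartite graph with edges (x, f_i x), of the dim V
   leading positions of V.  If all sets of at most L points of X span forests,
   this number is at least (d - 1) dim V as soon as dim V <= L.  So if a
   submodule U of kX + kY is a direct sum of modules of dimension at most L,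
   its part at vertex 1 has dimension at most (dim U) / d; for d = 3 and
   |Y| < 3/2 |X| such a U cannot have codimension at most (|X| + |Y|) / 10.

   Graphs with these properties are obtained, starting from a point, by
   iterating the cover of G = (X, Y) with voltages in Z^E, where E is the set
   of edges and the voltage of an edge e is the basis vector delta_e.  It is
   cut down to X * [0, n)^E and Y * [0, n]^E, which for large n hardly changes
   the ratio of the cardinals, and ordered lexicographically.  A set S of
   points of the cover is a forest if its projection to G is injective (then
   no cycle can have total voltage zero) or a forest (coverings of forests are
   forests); hence the bound L on the size of harmless sets increases by one. *)
Require Import Defs.
From HB Require Import structures.
From mathcomp Require Import all_boot all_order all_algebra all_field.
From mathcomp Require Import boolp reals.
From mathcomp Require Import zify ring lra.

Set Implicit Arguments.
Unset Strict Implicit.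
Unset Printing Implicit Defensive.

Import Order.TTheory GRing.Theory Num.Theory.
Local Open Scope ring_scope.

(** * Codes of digit vectors in base [q] *)

Lemma digits_lt m q (a : 'I_m -> nat) :
  (forall i, a i < q)%N -> (\sum_(i < m) a i * q ^ i < q ^ m)%N.
Proof.
elim: m a => [|m IHm] a ltaq; first by rewrite big_ord0 expn0.
rewrite big_ord_recr /= expnS.
have lt_low := IHm (a \o widen_ord (leqnSn m)) (fun i => ltaq _).
apply: (@leq_trans ((a ord_max).+1 * q ^ m)); last by rewrite leq_mul2r ltaq orbT.
by rewrite mulSn ltn_add2r.
Qed.

Lemma digits_inj m q (a b : 'I_m -> nat) :
    (forall i, a i < q)%N -> (forall i, b i < q)%N ->
  (\sum_(i < m) a i * q ^ i = \sum_(i < m) b i * q ^ i)%N -> a =1 b.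
Proof.
elim: m a b => [|m IHm] a b ltaq ltbq; first by move=> _ [].
rewrite !big_ord_recr /=.
set w := widen_ord (leqnSn m) => Eab.
have lta := digits_lt (fun i => ltaq (w i)).
have ltb := digits_lt (fun i => ltbq (w i)).
have q_gt0 : (0 < q ^ m)%N by apply: leq_ltn_trans lta.
have Emax : a ord_max = b ord_max.
  have /(congr1 (divn^~ (q ^ m)%N)) := Eab.
  by rewrite !divnDMl // !divn_small.
have Elow i : a (w i) = b (w i).
  by apply: (IHm (a \o w) (b \o w)) => // [j|j|]; rewrite /= ?ltaq ?ltbq //;
     move: Eab; rewrite Emax => /addIn.
move=> i; case: (ltnP i m) => [lt_im | le_mi].
  by rewrite (_ : i = w (Ordinal lt_im)) ?Elow //; apply: val_inj.
by rewrite (_ : i = ord_max) //; apply/val_inj/eqP; rewrite eqn_leq le_mi -ltnS ltn_ord.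
Qed.

Section Code.
Variables (E : finType) (q : nat).
Implicit Types a b : E -> nat.

Definition code a := (\sum_(e : E) a e * q ^ enum_rank e)%N.

Lemma code_ord a : code a = (\sum_(i < #|E|) a (enum_val i) * q ^ i)%N.
Proof.
rewrite /code (reindex _ (onW_bij _ (@enum_val_bij E))) /=.
by apply: eq_bigr => i _; rewrite enum_valK.
Qed.

Lemma code_lt a : (forall e, a e < q)%N -> (code a < q ^ #|E|)%N.
Proof. by move=> ltaq; rewrite code_ord digits_lt. Qed.

Lemma code_inj a b :
  (forall e, a e < q)%N -> (forall e, b e < q)%N -> code a = code b -> a =1 b.
Proof.
move=> ltaq ltbq; rewrite !code_ord => Eab e; rewrite -(enum_rankK e).
by apply: (digits_inj (a := a \o enum_val) (b := b \o enum_val) _ _ Eab) => i /=.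
Qed.

(** The increment is independent of [a]: a unit step along [e0] shifts all codes alike, hence
    preserves their order. *)
Lemma code_incr a e0 :
  code (fun e => (e == e0) + a e)%N = (q ^ enum_rank e0 + code a)%N.
Proof.
rewrite /code; under eq_bigr do rewrite mulnDl.
rewrite big_split /=; congr addn.
by rewrite (bigD1 e0) //= eqxx mul1n big1 ?addn0 // => e /negPf->.
Qed.

End Code.

(** * Ranked bipartite graphs and forests *)

Record ranked_graph (d : nat) := RankedGraph {
  lv : finType;
  rv : finType;
  nbr : 'I_d -> lv -> rv;
  lrank : lv -> nat;
  rrank : rv -> nat;
  lrank_inj : injective lrank;
  rrank_inj : injective rrank;
  nbr_mono : forall i x x',
    (lrank x < lrank x')%N -> (rrank (nbr i x) < rrank (nbr i x'))%N }.

Section Graph.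
Variables (d : nat) (G : ranked_graph d).
Implicit Types S : {set lv G}.

Lemma nbr_inj i : injective (@nbr d G i).
Proof.
move=> x x' Exx'; apply: (@lrank_inj _ G); apply/eqP.
by case: ltngtP => // /(nbr_mono i); rewrite Exx' ltnn.
Qed.

Definition nbrs S : {set rv G} := [set nbr i x | i in 'I_d, x in S].

(* The subgraph of all edges at S is a forest, expressed as the vanishing of
   its first cohomology with rational coefficients. *)
Definition acyclic S := forall h : lv G -> 'I_d -> rat,
  exists u : lv G -> rat, exists v : rv G -> rat,
    forall x i, x \in S -> v (nbr i x) - u x = h x i.

End Graph.

(** * Dimension comparisons and the forest bound *)

Lemma linfunE (F : fieldType) (aT rT : vectType F) (f : aT -> rT) :
  linear f -> linfun f =1 f.
Proof.
move=> linf; pose g : {linear aT -> rT} :=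
  HB.pack f (GRing.isLinear.Build F aT rT *:%R f linf).
exact: (lfunE g).
Qed.

Lemma dim_img_le (F : fieldType) (aT rT : vectType F) (f : 'Hom(aT, rT))
    (U : {vspace aT}) :
  (\dim (f @: U) <= \dim U)%N.
Proof. by rewrite -(limg_ker_dim f U) leq_addl. Qed.

Lemma dim_surj (F : fieldType) (aT rT : vectType F) (f : 'Hom(aT, rT))
    (U : {vspace aT}) (W : {vspace rT}) :
  (forall w, w \in W -> exists2 u, u \in U & f u = w) -> (\dim W <= \dim U)%N.
Proof.
move=> surjf; have sWfU : (W <= f @: U)%VS.
  by apply/subvP => w /surjf[u Uu <-]; apply: memv_img.
exact: leq_trans (dimvS sWfU) (dim_img_le _ _).
Qed.

Lemma dim_inj (F : fieldType) (aT rT : vectType F) (f : 'Hom(aT, rT))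
    (U : {vspace aT}) (W : {vspace rT}) :
    (forall u, u \in U -> f u \in W) -> (forall u, u \in U -> f u = 0 -> u = 0) ->
  (\dim U <= \dim W)%N.
Proof.
move=> fUW injf; rewrite -(limg_ker_dim f U).
rewrite (_ : U :&: lker f = 0)%VS ?dimv0 ?dimvS //.
  by apply/subvP => _ /memv_imgP[u Uu ->]; apply: fUW.
apply/eqP; rewrite -subv0; apply/subvP => u.
by rewrite memv_cap memv_ker memv0 => /andP[Uu /eqP/(injf _ Uu)->].
Qed.

Lemma dim_ffun (F : fieldType) (I : finType) : \dim {:{ffun I -> F^o}} = #|I|.
Proof. by rewrite dimvf /dim /= muln1. Qed.

(** By acyclicity the coboundary from functions on the vertices in [S] and [nbrs S] to functions on
    the [d * #|S|] edges at [S] is onto; compare dimensions. *)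
Lemma acyclic_card d (G : ranked_graph d) (S : {set lv G}) :
  acyclic S -> (d * #|S| <= #|S| + #|nbrs S|)%N.
Proof.
move=> acS.
pose A := ({x | x \in S} + {y | y \in nbrs S})%type.
pose B := ({x | x \in S} * 'I_d)%type.
have nbrP (e : B) : nbr e.2 (val e.1) \in nbrs S.
  by apply/imset2P; exists e.2 (val e.1); rewrite ?(valP e.1).
pose nb (e : B) : {y | y \in nbrs S} := exist (fun y => y \in nbrs S) _ (nbrP e).
pose delta (w : {ffun A -> rat^o}) : {ffun B -> rat^o} :=
  [ffun e => w (inr (nb e)) - w (inl e.1)].
have delta_lin : linear delta.
  move=> c w w'; apply/ffunP => e; rewrite !ffunE.
  by rewrite scalerBr opprD addrACA.
have -> : (#|S| + #|nbrs S|)%N = \dim {:{ffun A -> rat^o}}.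
  by rewrite dim_ffun card_sum !card_sig; congr addn; apply: eq_card.
have -> : (d * #|S|)%N = \dim {:{ffun B -> rat^o}}.
  by rewrite dim_ffun card_prod card_ord card_sig mulnC; congr muln; apply: eq_card.
apply: (dim_surj (f := linfun delta)) => h _.
pose h' x i : rat := if insub x is Some x' then h (x', i) else 0.
have [u [v uvh]] := acS h'.
exists [ffun a => match a with inl x => u (val x) | inr y => v (val y) end].
  exact: memvf.
rewrite linfunE //; apply/ffunP => -[x i]; rewrite !ffunE /=.
by rewrite uvh ?(valP x) // /h' valK.
Qed.

(** * Voltage covers of a ranked graph *)

Lemma block_inj K r r' c c' : (c < K)%N -> (c' < K)%N ->
  (r * K + c = r' * K + c')%N -> r = r' /\ c = c'.
Proof.
move=> cK c'K Er; have K_gt0 : (0 < K)%N by apply: leq_ltn_trans cK.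
have Err' : r = r'.
  by have /(congr1 (divn^~ K)) := Er; rewrite !divnMDl // !divn_small // !addn0.
by split=> //; move: Er; rewrite Err' => /addnI.
Qed.

Section Cover.
Variables (d : nat) (G : ranked_graph d) (n : nat).

Local Notation E := (lv G * 'I_d)%type.
Local Notation code := (@code E n.+1).

(* The edge e goes from sheet a to sheet a + delta_e. *)
Definition step (a : {ffun E -> 'I_n}) (e : E) : {ffun E -> 'I_n.+1} :=
  [ffun e' => inord ((e' == e) + a e')].

(** [inord] never falls back to its default: left coordinates are below [n], and the right side has
    one more value to absorb the step. *)
Lemma stepE a e e' : step a e e' = ((e' == e) + a e')%N :> nat.
Proof.
rewrite ffunE inordK // ltnS.
by case: eqP => _; [apply: (ltn_ord (a e')) | apply/ltnW/(ltn_ord (a e'))].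
Qed.

Definition cover_nbr (i : 'I_d) (p : lv G * {ffun E -> 'I_n}) :
    rv G * {ffun E -> 'I_n.+1} :=
  (nbr i p.1, step p.2 (p.1, i)).

Definition cover_lrank (p : lv G * {ffun E -> 'I_n}) :=
  (lrank p.1 * n.+1 ^ #|{: E}| + code (fun e => p.2 e))%N.

Definition cover_rrank (p : rv G * {ffun E -> 'I_n.+1}) :=
  (rrank p.1 * n.+1 ^ #|{: E}| + code (fun e => p.2 e))%N.

Lemma code_ltl (a : {ffun E -> 'I_n}) : (code (fun e => a e) < n.+1 ^ #|{: E}|)%N.
Proof. by apply: code_lt => e; rewrite ltnW // ltnS. Qed.

Lemma code_ltr (a : {ffun E -> 'I_n.+1}) :
  (code (fun e => a e) < n.+1 ^ #|{: E}|)%N.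
Proof. exact: code_lt. Qed.

Lemma cover_lrank_inj : injective cover_lrank.
Proof.
move=> [x a] [x' a'] /(block_inj (code_ltl _) (code_ltl _))[/= /lrank_inj-> Ea].
congr pair; apply/ffunP => e; apply: val_inj.
by apply: code_inj Ea e => e; rewrite ltnW // ltnS.
Qed.

Lemma cover_rrank_inj : injective cover_rrank.
Proof.
move=> [x a] [x' a'] /(block_inj (code_ltr _) (code_ltr _))[/= /rrank_inj-> Ea].
by congr pair; apply/ffunP => e; apply: val_inj; apply: code_inj Ea e.
Qed.

Lemma code_step a e :
  code (fun e' => step a e e') = (n.+1 ^ enum_rank e + code (fun e' => a e'))%N.
Proof. by rewrite -code_incr; apply: eq_bigr => e' _; rewrite stepE. Qed.

(** Inside a fibre both codes grow by the same amount; between fibres the ranks in [G] decide, since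
    every code is smaller than a block. *)
Lemma cover_mono i p p' : (cover_lrank p < cover_lrank p')%N ->
  (cover_rrank (cover_nbr i p) < cover_rrank (cover_nbr i p'))%N.
Proof.
case: p p' => [x a] [x' a']; rewrite /cover_lrank /cover_rrank /=.
set K := (n.+1 ^ #|_|)%N => lt_pp'.
have : (lrank x <= lrank x')%N.
  rewrite leqNgt; apply: contraL lt_pp' => lt_x'x.
  rewrite -leqNgt (leq_trans (ltnW _) (leq_addr _ _)) //.
  apply: (@leq_trans ((lrank x').+1 * K)); last by rewrite leq_mul2r lt_x'x orbT.
  by rewrite mulSnr ltn_add2l code_ltl.
rewrite leq_eqVlt => /predU1P[/lrank_inj Exx' | lt_xx'].
  by move: lt_pp'; rewrite Exx' !code_step !ltn_add2l.
apply: leq_trans (leq_addr _ _).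
apply: (@leq_trans ((rrank (nbr i x)).+1 * K)).
  by rewrite mulSnr ltn_add2l code_ltr.
by rewrite leq_mul2r (nbr_mono i lt_xx') orbT.
Qed.

Definition graph_cover : ranked_graph d :=
  RankedGraph cover_lrank_inj cover_rrank_inj cover_mono.

Implicit Types S : {set lv graph_cover}.

(* The sheet coordinates themselves are the potentials. *)
Lemma cover_acyclic_inj S : {in S &, injective fst} -> acyclic S.
Proof.
move=> injS h.
(* By injectivity [h] descends to the edges of [G]; only the coordinate of the traversed edge
   changes, so all other terms cancel. *)
pose g e := if [pick p in S | p.1 == e.1] is Some p then h p e.2 else 0.
exists (fun p : lv G * {ffun E -> 'I_n} => \sum_e (p.2 e)%:R * g e).
exists (fun p : rv G * {ffun E -> 'I_n.+1} => \sum_e (p.2 e)%:R * g e).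
move=> p i Sp; rewrite -sumrB (bigD1 (p.1, i)) //= big1 => [|e /negPf nep].
  rewrite stepE eqxx natrD mulrDl mul1r addrK addr0 /g /=.
  case: pickP => [p' /andP[Sp' /eqP Ep] | /(_ p)]; last by rewrite Sp eqxx.
  by rewrite (injS _ _ Sp' Sp Ep).
by rewrite stepE nep subrr.
Qed.

(* Over a forest the covering is trivial: subtracting a potential r of the
   voltage from the code of the sheet gives a locally constant function, whose
   fibres embed into the forest. *)
Lemma cover_acyclic S : acyclic [set p.1 | p in S] -> acyclic S.
Proof.
move=> acS h.
have [r [s rs]] := acS (fun x i => (n.+1 ^ enum_rank (x, i))%:R).
pose sheet (p : lv G * {ffun E -> 'I_n}) : rat := (code (fun e => p.2 e))%:R - r p.1.
(* The part of [h] with label [b], seen on [G]; a point is determined by its vertex and its label,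
   so the pick is unambiguous. *)
pose hb b x i :=
  if [pick p in S | (p.1 == x) && (sheet p == b)] is Some p then h p i else 0.
have /choice[uv uvP] b : exists uv : (lv G -> rat) * (rv G -> rat),
    forall x i, x \in [set p.1 | p in S] -> uv.2 (nbr i x) - uv.1 x = hb b x i.
  by have [u [v uvh]] := acS (hb b); exists (u, v).
exists (fun p : lv G * {ffun E -> 'I_n} => (uv (sheet p)).1 p.1).
exists (fun p : rv G * {ffun E -> 'I_n.+1} =>
  (uv ((code (fun e => p.2 e))%:R - s p.1)).2 p.1).
move=> p i Sp /=; have pS : p.1 \in [set p.1 | p in S] by apply: imset_f.
rewrite code_step natrD -(rs _ i pS) (_ : _ - _ + _ - _ = sheet p); last first.
  by rewrite /sheet; ring.
rewrite uvP // /hb; case: pickP => [p' | /(_ p)]; last by rewrite Sp !eqxx.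
case/and3P=> Sp' /eqP Ep1; rewrite /sheet Ep1 => /eqP/addIr/eqP.
rewrite eqr_nat => /eqP Ep2; congr (h _ i).
by apply: cover_lrank_inj; rewrite /cover_lrank Ep1 Ep2.
Qed.

Lemma cover_small_acyclic L :
    (forall S : {set lv G}, (#|S| <= L)%N -> acyclic S) ->
  forall S, (#|S| <= L.+1)%N -> acyclic S.
Proof.
move=> acG S leSL; have [/imset_injP injS | ninjS] := boolP (#|[set p.1 | p in S]| == #|S|).
  exact: cover_acyclic_inj.
apply/cover_acyclic/acG; rewrite -ltnS (leq_trans _ leSL) //.
by rewrite ltn_neqAle ninjS leq_imset_card.
Qed.

End Cover.

(** * Sparse graphs whose small sets are acyclic *)

Lemma bernoulli_nat n e :
  (n.+1 ^ e * n.+1 <= n ^ e * n.+1 + n.+1 ^ e * e)%N.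
Proof.
elim: e => [|e IHe]; first by rewrite !expn0; lia.
rewrite !expnS; set a := (n.+1 ^ e)%N in IHe *; set b := (n ^ e)%N in IHe *.
nia.
Qed.

Lemma sparse_acyclic_graph d L : exists G : ranked_graph d,
  (2 * #|rv G| < 3 * #|lv G|)%N /\
  forall S : {set lv G}, (#|S| <= L)%N -> acyclic S.
Proof.
elim: L => [|L [G [ltYX acG]]].
  have inj_unit : injective (fun _ : unit => 0%N) by move=> [] [].
  (* One point on each side with [d] parallel edges; only the empty set has to be acyclic. *)
  exists (@RankedGraph d _ _ (fun _ _ => tt) _ _ inj_unit inj_unit (fun _ _ _ => id)).
  split=> [|S]; first by rewrite card_unit.
  rewrite leqn0 cards_eq0 => /eqP-> h.
  by exists (fun _ => 0), (fun _ => 0) => x i; rewrite inE.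
(* Bernoulli gives [(n / n.+1) ^ e >= 1 - e / n.+1], and this [n] makes the loss smaller than
   [1 / (2 * #|rv G|).+1]; the integral gap [2 * #|rv G| + 1 <= 3 * #|lv G|] absorbs it. *)
pose e := #|{: lv G * 'I_d}|; pose n := (e * (2 * #|rv G|).+1)%N.
exists (graph_cover G n); split; last exact: cover_small_acyclic.
rewrite /= !card_prod !card_ffun !card_ord -/e.
have := bernoulli_nat n e.
have : (0 < n.+1 ^ e)%N by rewrite expn_gt0.
set a := (n.+1 ^ e)%N; set b := (n ^ e)%N => a_gt0 le_ab.
have le1 : (a * n.+1 * (2 * #|rv G|).+1 <= (b * n.+1 + a * e) * (2 * #|rv G|).+1)%N.
  by rewrite leq_mul2r le_ab orbT.
have le2 : (b * n.+1 * (2 * #|rv G|).+1 <= b * n.+1 * (3 * #|lv G|))%N.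
  by rewrite leq_mul2l ltYX orbT.
rewrite -(@ltn_pmul2r n.+1) //.
have En : (a * n = a * e * (2 * #|rv G|).+1)%N by rewrite /n mulnA.
move: le1 le2; rewrite mulnDl -En; set m := #|rv G|; set l := #|lv G|.
move=> le1 le2.
have le3 : (a * n.+1 * (2 * m) + a <= b * n.+1 * (3 * l))%N by nia.
by nia.
Qed.

(** * Leading positions of subspaces and their pushforwards *)

Section Lead.
Variables (F : fieldType) (X : finType) (r : X -> nat).
Implicit Types (u : {ffun X -> F^o}) (V : {vspace {ffun X -> F^o}}).

Definition is_lead u x :=
  (u x != 0) && [forall y, (r x < r y)%N ==> (u y == 0)].

Lemma is_leadP u x :
  reflect (u x != 0 /\ forall y, (r x < r y)%N -> u y = 0) (is_lead u x).
Proof.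
apply: (iffP andP) => -[ux0 uy0]; split=> //.
  by move=> y lt_xy; apply/eqP/(implyP (forallP uy0 y)).
by apply/forallP => y; apply/implyP => /uy0->.
Qed.

Lemma lead_exists u : u != 0 -> exists x, is_lead u x.
Proof.
move=> u0; have [x0 ux0] : exists x, u x != 0.
  apply/existsP; apply: contraR u0; rewrite negb_exists => /forallP u0.
  by apply/eqP/ffunP => x; rewrite ffunE; apply/eqP; have := u0 x; rewrite negbK.
case: (@arg_maxnP _ x0 (fun x => u x != 0) r ux0) => x ux maxx.
exists x; apply/is_leadP; split=> // y; rewrite ltnNge => /negP lt_xy.
by apply/eqP; apply: contra_notT lt_xy => /maxx.
Qed.

Definition leads V : {set X} :=
  [set x | `[< exists2 u, u \in V & is_lead u x >]].

Lemma leadsP V x : reflect (exists2 u, u \in V & is_lead u x) (x \in leads V).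
Proof. by rewrite inE; apply: asboolP. Qed.

End Lead.

(** Echelon form: restriction to the leading positions is injective on [V], and vectors with
    distinct leading positions are independent. *)
Lemma card_leads (F : fieldType) (X : finType) (r : X -> nat)
    (V : {vspace {ffun X -> F^o}}) :
  injective r -> #|leads r V| = \dim V.
Proof.
move=> r_inj; pose S := {x | x \in leads r V}.
have <- : \dim {:{ffun S -> F^o}} = #|leads r V|.
  by rewrite dim_ffun card_sig; apply: eq_card.
apply/eqP; rewrite eqn_leq; apply/andP; split; last first.
  pose res (u : {ffun X -> F^o}) : {ffun S -> F^o} := [ffun x => u (val x)].
  have res_lin : linear res by move=> c u v; apply/ffunP => x; rewrite !ffunE.
  apply: (dim_inj (f := linfun res)) => [u _ | u Vu]; first exact: memvf.
  rewrite linfunE // => /ffunP res0; apply/eqP; apply: contraT.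
  move=> /(lead_exists r)[x lead_ux].
  have Sx : x \in leads r V by apply/leadsP; exists u.
  have := res0 (exist (fun x => x \in leads r V) x Sx); rewrite !ffunE /= => ux0.
  by have /is_leadP[] := lead_ux; rewrite ux0 eqxx.
have /choice[w wP] (x : S) : exists w, w \in V /\ is_lead r w (val x).
  by have /leadsP[w] := valP x; exists w.
pose comb (c : {ffun S -> F^o}) : {ffun X -> F^o} := \sum_x (c x : F) *: w x.
have comb_lin : linear comb.
  move=> a c c'; rewrite /comb scaler_sumr -big_split /=.
  by apply: eq_bigr => x _; rewrite !ffunE scalerDl scalerA.
apply: (dim_inj (f := linfun comb)) => [c _ | c _]; rewrite linfunE //.
  by apply: memv_suml => x _; apply/memvZ; case: (wP x).
move=> comb0; apply/eqP; apply: contraT => /(lead_exists (r \o val))[x].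
case/is_leadP => cx0 c_hi; have [_ /is_leadP[wx0 _]] := wP x.
have /ffunP/(_ (val x)) := comb0; rewrite sum_ffunE (bigD1 x) //= big1.
  move=> /eqP; rewrite addr0 !ffunE.
  by rewrite (mulf_eq0 (c x) (w x (val x))) (negPf cx0) (negPf wx0).
move=> y neyx; rewrite ffunE; case: (ltngtP (r (val x)) (r (val y))) => [lt_xy | lt_yx | ].
- by rewrite (c_hi y lt_xy) scale0r.
- by have [_ /is_leadP[_ ->]] := wP y; rewrite ?scaler0.
- by move=> /r_inj/val_inj Exy; rewrite Exy eqxx in neyx.
Qed.

(* The pushforwards are monotone on bases, hence map leading positions to
   leading positions, whatever the field. *)
Section Push.
Variables (F : fieldType) (d : nat) (G : ranked_graph d).

Definition push i (u : {ffun lv G -> F^o}) : {ffun rv G -> F^o} :=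
  [ffun y => \sum_(x | nbr i x == y) u x].

Lemma push_linear i : linear (push i).
Proof.
move=> c u v; apply/ffunP => y; rewrite !ffunE scaler_sumr -big_split /=.
by apply: eq_bigr => x _; rewrite !ffunE.
Qed.

Lemma push_lead i u x :
  is_lead (@lrank d G) u x -> is_lead (@rrank d G) (push i u) (nbr i x).
Proof.
case/is_leadP => ux0 u_hi; apply/is_leadP; split=> [|y lt_xy].
  rewrite ffunE (eq_bigl (pred1 x)) ?big_pred1_eq // => x'.
  by rewrite /= (inj_eq (@nbr_inj _ _ i)).
rewrite ffunE big1 // => x' /eqP Ey; apply: u_hi.
rewrite ltnNge; apply: contraL lt_xy; rewrite -Ey -leqNgt leq_eqVlt.
by case/predU1P => [/lrank_inj-> // | /(nbr_mono i)/ltnW].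
Qed.

(** The set of leading positions of [V] has [\dim V <= L] points, so the forest bound applies to it,
    and all its neighbours are leading positions of [W]. *)
Lemma push_expansion (L : nat) (V : {vspace {ffun lv G -> F^o}})
    (W : {vspace {ffun rv G -> F^o}}) :
    (forall S : {set lv G}, (#|S| <= L)%N -> acyclic S) ->
    (forall i u, u \in V -> push i u \in W) -> (\dim V <= L)%N ->
  (d * \dim V <= \dim V + \dim W)%N.
Proof.
move=> acG VW.
rewrite -(card_leads V (@lrank_inj _ G)) -(card_leads W (@rrank_inj _ G)).
move=> /acG/acyclic_card/leq_trans-> //.
rewrite leq_add2l subset_leq_card //; apply/subsetP => _ /imset2P[i x _ Vx ->].
have /leadsP[u Vu lead_ux] := Vx.
by apply/leadsP; exists (push i u); [apply: VW | apply: push_lead].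
Qed.

End Push.

(** * Ranks of algebra elements on modules *)

Section ModuleRank.
Variables (k : fieldType) (A : falgType k).
Implicit Types (M N : fdmod A) (a : A).

Definition equivariant M N (f : 'Hom(M, N)) := forall a m, f (act a m) = act a (f m).

(** For the idempotent of vertex 1 this is the dimension of the representation at that vertex,
    without splitting the module explicitly. *)
Definition act_rank a M := \dim (limg (linfun (@act k A M a))).

Lemma linfun_actE a M m : linfun (@act k A M a) m = act a m.
Proof. exact/linfunE/act_linearr. Qed.

Lemma act_rank_surj a M N (g : 'Hom(M, N)) :
  equivariant g -> (forall n, exists m, g m = n) -> (act_rank a N <= act_rank a M)%N.
Proof.
move=> gA surjg; apply: (dim_surj (f := g)) => _ /memv_imgP[n _ ->].
have [m <-] := surjg n; exists (linfun (@act k A M a) m).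
  exact/memv_img/memvf.
by rewrite !linfun_actE gA.
Qed.

Lemma act_rank_zero a : act_rank a (mod_zero A) = 0%N.
Proof.
by apply/eqP; rewrite -leqn0 (leq_trans (dimvS (subvf _))) // dimvf.
Qed.

Lemma act_rank_sum a M N :
  (act_rank a (mod_sum M N) <= act_rank a M + act_rank a N)%N.
Proof.
pose inl_ (m : M) : M * N := (m, 0); pose inr_ (n : N) : M * N := (0, n).
have inl_lin : linear inl_ by move=> c m m'; congr pair; rewrite /= scaler0 addr0.
have inr_lin : linear inr_ by move=> c m m'; congr pair; rewrite /= scaler0 addr0.
set IM := limg (linfun (@act k A M a)); set IN := limg (linfun (@act k A N a)).
apply: (@leq_trans (\dim (linfun inl_ @: IM + linfun inr_ @: IN))).
  apply/dimvS/subvP => _ /memv_imgP[[m n] _ ->]; rewrite linfun_actE.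
  apply/memv_addP; exists (inl_ (act a m)).
    by rewrite -(linfunE inl_lin) -linfun_actE !memv_img ?memvf.
  exists (inr_ (act a n)).
    by rewrite -(linfunE inr_lin) -linfun_actE !memv_img ?memvf.
  by congr pair; rewrite /= ?addr0 ?add0r.
rewrite (leq_trans (dimv_add_leqif _ _)) //.
by apply: leq_add; apply: dim_img_le.
Qed.

Lemma dim_mod_sum M N : \dim {:mod_sum M N} = (\dim {:M} + \dim {:N})%N.
Proof. by rewrite !dimvf. Qed.

End ModuleRank.

(** * The Kronecker module of a ranked graph *)

Section KroneckerModule.
Variables (k : fieldType) (d : nat) (G : ranked_graph d).
Local Notation A := (kronecker_algebra k d).
Local Notation LF := {ffun lv G -> k^o}.
Local Notation RF := {ffun rv G -> k^o}.

Definition graph_act (a : A) (m : LF * RF) : LF * RF :=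
  ((a (inl false) : k) *: m.1,
   (a (inl true) : k) *: m.2 + \sum_i (a (inr i) : k) *: push i m.1).

Lemma graph_act_linearl m : linear (graph_act^~ m).
Proof.
move=> c a b; rewrite /graph_act; congr pair; rewrite /= !ffunE.
  by rewrite scalerDl scalerA.
rewrite scalerDr scalerDl scalerA addrACA; congr (_ + _).
rewrite scaler_sumr -big_split /=; apply: eq_bigr => i _.
by rewrite !ffunE scalerDl scalerA.
Qed.

Lemma graph_act_linearr a : linear (graph_act a).
Proof.
move=> c [u v] [u' v']; rewrite /graph_act; congr pair; rewrite /=.
  by rewrite scalerDr !scalerA mulrC.
rewrite scalerDr (scalerDr c) addrACA !scalerA mulrC; congr (_ + _).
rewrite scaler_sumr -big_split /=; apply: eq_bigr => i _.
by rewrite push_linear scalerDr !scalerA mulrC.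
Qed.

Lemma graph_act1 m : graph_act 1 m = m.
Proof.
case: m => u v; rewrite /graph_act; congr pair; rewrite /= !ffunE ?scale1r //.
by rewrite big1 ?addr0 // => i _; rewrite ffunE scale0r.
Qed.

Lemma graph_actM a b m : graph_act (a * b) m = graph_act a (graph_act b m).
Proof.
case: m => u v; rewrite /graph_act /=.
have mulv w : (a * b) (inl w) = a (inl w) * b (inl w) :> k by apply: kmul_vertex.
have mula i : (a * b) (inr i) =
    a (inr i) * b (inl false) + a (inl true) * b (inr i) :> k by apply: kmul_arrow.
rewrite !mulv; congr pair; first by rewrite scalerA.
rewrite scalerDr scalerA -addrA; congr (_ + _).
rewrite scaler_sumr -big_split /=; apply: eq_bigr => i _.
rewrite mula scalerDl addrC !scalerA; congr (_ + _).
have pushZ c : push i (c *: u) = c *: push i u.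
  apply/ffunP => y; rewrite !ffunE scaler_sumr.
  by apply: eq_bigr => x _; rewrite ffunE.
by rewrite pushZ scalerA.
Qed.

Definition graph_mod : fdmod A :=
  @FdMod k A (LF * RF)%type graph_act graph_act_linearl graph_act_linearr
    graph_act1 graph_actM.

Definition idem : A := [ffun p => (p == inl false)%:R : k].
Definition arrow i : A := [ffun p => (p == inr i)%:R : k].

Lemma idem_act m : @act _ _ graph_mod idem m = (m.1, 0) :> LF * RF.
Proof.
rewrite /= /graph_act !ffunE eqxx scale1r scale0r add0r big1 // => i _.
by rewrite ffunE scale0r.
Qed.

Lemma arrow_act i u : @act _ _ graph_mod (arrow i) (u, 0) = (0, push i u) :> LF * RF.
Proof.
rewrite /= /graph_act !ffunE scale0r scaler0 add0r (bigD1 i) //= big1 => [|j neji].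
  by rewrite ffunE eqxx scale1r addr0.
by rewrite ffunE (inj_eq (@inr_inj _ _)) (negPf neji) scale0r.
Qed.

End KroneckerModule.

(** * Submodules that split into small summands *)

Section SmallSubmodules.
Variables (k : fieldType) (d : nat) (G : ranked_graph d) (L : nat).
Hypothesis acG : forall S : {set lv G}, (#|S| <= L)%N -> acyclic S.
Local Notation A := (kronecker_algebra k d).
Local Notation M := (graph_mod k G).
Local Notation LF := {ffun lv G -> k^o}.
Local Notation RF := {ffun rv G -> k^o}.
Local Notation e1 := (idem k d).

(** The image of [N] contains [V] at vertex 1 and [W] at vertex 2, so [\dim V + \dim W] is at most
    the dimension of [N]; [e1 N] embeds in [V], and expansion bounds [d * \dim V]. *)
Lemma rank_small_submodule (N : fdmod A) (f : 'Hom(N, M)) :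
    injective f -> equivariant f -> (\dim {:N} <= L)%N ->
  (d * act_rank e1 N <= \dim {:N})%N.
Proof.
move=> injf fA leNL.
pose inl_ (u : LF) : LF * RF := (u, 0); pose inr_ (v : RF) : LF * RF := (0, v).
have inl_lin : linear inl_ by move=> c m m'; congr pair; rewrite /= scaler0 addr0.
have inr_lin : linear inr_ by move=> c m m'; congr pair; rewrite /= scaler0 addr0.
have fst_lin : linear (fst : LF * RF -> LF) by [].
pose I : {vspace LF * RF} := limg f.
have IA a m : m \in I -> graph_act a m \in I.
  by case/memv_imgP => n _ ->; rewrite -[graph_act _ _]/(act a (f n)) -fA memv_img ?memvf.
pose V := (linfun inl_ @^-1: I)%VS; pose W := (linfun inr_ @^-1: I)%VS.
have VE u : (u \in V) = ((u, 0) \in I) by rewrite -memv_preim linfunE.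
have WE v : (v \in W) = ((0, v) \in I) by rewrite -memv_preim linfunE.
have leVW : (\dim V + \dim W <= \dim {:N})%N.
  apply: (@leq_trans (\dim I)); last exact: dim_img_le.
  rewrite -(limg_ker_dim (linfun (fst : LF * RF -> LF)) I) addnC leq_add //.
    apply: (dim_inj (f := linfun inr_)) => [v | v _]; rewrite linfunE //.
      by rewrite WE memv_cap memv_ker linfunE // => ->; rewrite /= eqxx.
    by case.
  apply/dimvS/subvP => u; rewrite VE => Iu.
  by apply/memv_imgP; exists (u, 0); rewrite ?linfunE.
have leRV : (act_rank e1 N <= \dim V)%N.
  pose p (n : N) : LF := (f n).1.
  have p_lin : linear p by move=> c n n'; rewrite /p linearP.
  apply: (dim_inj (f := linfun p)) => _ /memv_imgP[n _ ->]; rewrite linfun_actE linfunE //.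
    rewrite VE /p fA idem_act /= -idem_act; apply: IA; exact/memv_img/memvf.
  rewrite /p fA idem_act /= => fn0; apply: injf.
  by rewrite fA idem_act fn0 linear0.
apply: (leq_trans _ leVW); apply: (@leq_trans (d * \dim V)).
  by rewrite leq_mul2l leRV orbT.
apply: (push_expansion acG) => [i u|].
  by rewrite VE WE -arrow_act => /IA; apply.
exact: leq_trans (leq_trans (leq_addr _ _) leVW) leNL.
Qed.

(** Restricting [f] to a summand keeps it injective and equivariant, and the rank is subadditive, so
    the bounds for the summands add up. *)
Lemma rank_sum_of_small (t : nat) (N : 'I_t -> fdmod A)
    (B := \big[@mod_sum k A/mod_zero A]_(i < t) N i) (f : 'Hom(B, M)) :
    (forall i, \dim {:N i} <= L)%N -> injective f -> equivariant f ->
  (d * act_rank e1 B <= \dim {:B})%N.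
Proof.
move=> leNL; rewrite /B in f *; move: f.
apply: (big_rec (fun B : fdmod A => forall f : 'Hom(B, M), injective f ->
  equivariant f -> (d * act_rank e1 B <= \dim {:B})%N)) => [|i B' _ IHB] f injf fA.
  by rewrite act_rank_zero muln0.
pose inl_ (m : N i) : N i * B' := (m, 0); pose inr_ (n : B') : N i * B' := (0, n).
have inl_lin : linear inl_ by move=> c m m'; congr pair; rewrite /= scaler0 addr0.
have inr_lin : linear inr_ by move=> c m m'; congr pair; rewrite /= scaler0 addr0.
have act0 (P : fdmod A) a : act a 0 = 0 :> P by rewrite -linfun_actE linear0.
rewrite dim_mod_sum (leq_trans (leq_mul (leqnn d) (act_rank_sum _ _ _))) //.
rewrite mulnDr leq_add //.
  apply: (@rank_small_submodule _ (f \o linfun inl_)%VF) => [m m' | a m | //].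
    by rewrite !comp_lfunE !linfunE // => /injf[].
  rewrite !comp_lfunE !linfunE // -fA; congr (f _).
  by rewrite /= /sum_act /= act0.
apply: (IHB (f \o linfun inr_)%VF) => [m m' | a m].
  by rewrite !comp_lfunE !linfunE // => /injf[].
rewrite !comp_lfunE !linfunE // -fA; congr (f _).
by rewrite /= /sum_act /= act0.
Qed.

(** The kernel of [e1] on [U] lies at vertex 2 and has dimension at most [#|rv G|], so [e1] has rank
    at least the difference; the isomorphism carries this rank to the direct sum. *)
Lemma dim_hyperfinite_submodule (U : {vspace M}) (sU : submodule U) (t : nat)
    (N : 'I_t -> fdmod A) :
    (forall i, \dim {:N i} <= L)%N ->
    mod_iso (mod_of_sub sU) (\big[@mod_sum k A/mod_zero A]_(i < t) N i) ->
  (d * (\dim U - #|rv G|) <= \dim U)%N.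
Proof.
move=> leNL [f [bijf fA]]; set B := bigop _ _ _ in f bijf fA.
have kerf : lker f == 0%VS by apply/lker0P/bij_inj.
have fVK : cancel f^-1%VF f.
  by have [g fK gK] := bijf => b; rewrite -[b]gK lker0_lfunK.
have gA : equivariant (M := B) (N := mod_of_sub sU) f^-1%VF.
  by move=> a b; apply: (bij_inj bijf); rewrite fVK fA fVK.
have val_lin : linear (val : mod_of_sub sU -> M) by [].
have dimU : \dim {:mod_of_sub sU} = \dim U by rewrite dimvf.
have leB : (d * act_rank e1 B <= \dim {:B})%N.
  apply: (@rank_sum_of_small _ _ (linfun (val : mod_of_sub sU -> M) \o f^-1)%VF) => //.
    move=> b b'; rewrite !comp_lfunE !linfunE // => /val_inj Eb.
    by rewrite -[b]fVK Eb fVK.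
  by move=> a b; rewrite !comp_lfunE !linfunE // gA.
have dimB : (\dim {:B} <= \dim U)%N.
  by rewrite -dimU; apply: (dim_inj (f := f^-1%VF)) => [*|b _ b0];
     rewrite ?memvf // -[b]fVK b0 linear0.
have leUB : (act_rank e1 (mod_of_sub sU) <= act_rank e1 B)%N.
  apply: (act_rank_surj _ gA) => u; exists (f u); exact: lker0_lfunK.
apply: leq_trans (leq_trans leB dimB); rewrite leq_mul2l; apply/orP; right.
apply: leq_trans leUB; rewrite leq_subLR.
set e := linfun (@act k A (mod_of_sub sU) e1).
rewrite -dimU -(limg_ker_dim e) leq_add2r.
pose snd_ (u : mod_of_sub sU) : RF := (val u : LF * RF).2.
have snd_lin : linear snd_ by [].
rewrite -(dim_ffun k (rv G)).
apply: (dim_inj (f := linfun snd_)) => [*|u]; first exact: memvf.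
rewrite memv_cap memv_ker linfun_actE linfunE // => /andP[_ /eqP eu0] u2.
apply: val_inj; have := congr1 val eu0; rewrite /= -[graph_act _ _]/(act e1 (val u)) idem_act.
by case=> u1; rewrite [LHS]surjective_pairing; congr pair.
Qed.

End SmallSubmodules.

Theorem theorem23 (R : realType) (k : fieldType) :
  exists d : nat, (3 <= d)%N /\ ~ amenable_type (kronecker_algebra k d) R.
Proof.
(* For [d = 3] a submodule [U] split into small summands has [2 * \dim U <= 3 * #|rv G|];
   codimension at most a tenth would force [3 * #|lv G| <= 2 * #|rv G|]. *)
exists 3%N; split=> // /(_ 10^-1)[|L [L_gt0 hyp]]; first by rewrite invr_gt0.
have [G [ltYX acG]] := sparse_acyclic_graph 3 (Num.bound L).
have [U [sU [t [N [geU leN isoU]]]]] := hyp (graph_mod k G) I.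
have leNL i : (\dim {:N i} <= Num.bound L)%N.
  rewrite -(ler_nat R) (le_trans (leN i)) // ltW //.
  by rewrite archi_boundP // ltW.
have := dim_hyperfinite_submodule acG leNL isoU.
have dimM : \dim {:graph_mod k G} = (#|lv G| + #|rv G|)%N.
  by rewrite -!(dim_ffun k) !dimvf.
rewrite dimM natrD in geU; rewrite mulnBr leq_subLR -(ler_nat R) natrD !natrM.
by move: ltYX; rewrite -(ltr_nat R) !natrM; lra.
Qed.
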